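(* Let $G$ be a non-abelian SSP group of $G(n,c(n,j))$-type, $n\ge3$, $0\le j\le q(n)-1$, of nilpotency class $2$, with canonical basis $(a_1,\dots,a_n)$ and presentation by the relations $R(n,j)$ and their shifts, as in the characterization of class-2 groups: (i) $a_1^p=e$; (ii) $[a_1,a_i]=e$ for $2\le i\le c(n,j)$; (iii) $[a_1,a_{c(n,j)+1+k}]\in\langle a_{q(n)+1-j},\dots,a_{q(n)+1+r(n)+2j+k}\rangle$ for $0\le k\le q(n)-j-1$, with $[a_1,a_{c(n,j)+1}]\ne e$. Suppose $\widehat G$ is a lifting of $G$, with canonical basis $(a_1,\dots,a_{n+1})$ and map $F$. Then there are integers (exponents) such that $\widehat G$ is presented by generators $a_1,\dots,a_{n+1}$ subject to the following relations $\widehat R$ together with all relations obtained by replacing each $a_i$ by $a_{i+t}$ for every $t\ge1$ for which all indices are at most $n+1$: (i) $a_1^p=e$ (omitted if $p=\infty$); (ii) $[a_1,a_i]=e$ for $2\le i\le c(n,j)$; (iii) for $0\le k\le q(n)-j-1$, $[a_1,a_{c(n,j)+1+k}]$ equals a specified product of powers of $a_{q(n)+2-j},\dots,a_{q(n)+r(n)+2j+k}$ (in increasing order of index), and this element is nontrivial for $k=0$; (iv) $[a_1,a_{n+1}]$ equals a specified product of powers of $a_{q(n)+1-j},\dots,a_{c(n,j)+1}$ (in increasing order of index).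
   Context: Notation: $x^f$ is the image of $x$ under $f$; $[x,y]=x^{-1}y^{-1}xy$; $e$ is the identity. A triple $(G,H,f)$, where $H\le G$ and $f:H\to G$ is a homomorphism, is simple if the only subgroup $K\le H$ that is normal in $G$ and satisfies $K^f\le K$ is trivial. For such a triple put $G_0=G$, $H_0=H$, and for $k\ge1$, $G_k=(H_{k-1})^f$, $H_k=H\cap G_k$. Let $p$ be a prime or $\infty$. A polycyclic group $G$ is an SSP group with respect to $(G,H,f)$ if: (1) $f$ is injective; (2) each $(G_k,H_k,f|_{H_k})$ is a simple triple; (3) $H_k$ and $G_{k+1}$ are normal in $G_k$ and $G_k=H_kG_{k+1}$; (4) whenever $G_k$ is nontrivial, $G_k/H_k$ is cyclic of order $p$ (infinite cyclic if $p=\infty$). The length $n$ is the Hirsch length if $p=\infty$ and $\log_p|G|$ if $p$ is prime. A canonical basis of $G$ is a tuple $(a_1,\dots,a_n)$ with $a_1,\dots,a_{n-1}\in H$, $a_{i+1}=a_i^f$ for $1\le i\le n-1$, $G_i=\langle a_{i+1},\dots,a_n\rangle$ and $H_i=\langle a_{i+1},\dots,a_{n-1}\rangle$ for $0\le i\le n-1$. The cut-off point $c$ is the largest $s\in\{2,\dots,n\}$ with $[a_1,a_2]=\dots=[a_1,a_s]=e$; $G$ is then of $G(n,c)$-type. Lifting: if $\widehat G$ is an SSP group of length $n+1$ with canonical basis $(a_1,\dots,a_{n+1})$ and map $F$, then $\widehat H=\langle a_1,\dots,a_n\rangle$ is an SSP group with respect to $(\widehat H,\langle a_1,\dots,a_{n-1}\rangle,F|)$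 with canonical basis $(a_1,\dots,a_n)$; $\widehat G$ is called a lifting of $\widehat H$. Write $n=3q(n)+r(n)$ with integers $q(n)\ge0$, $0\le r(n)\le2$, and $c(n,j)=2q(n)+r(n)+j$ for $0\le j\le q(n)$. *)

(* Defs.v *)
From Stdlib Require Import ZArith List Arith Znumtheory.
Open Scope nat_scope.
Import ListNotations.
Set Implicit Arguments.

Record group := Group {
  gcar :> Type;
  gmul : gcar -> gcar -> gcar;
  ginv : gcar -> gcar;
  gone : gcar;
  gmulA : forall x y z, gmul x (gmul y z) = gmul (gmul x y) z;
  gmul1l : forall x, gmul gone x = x;
  gmulVl : forall x, gmul (ginv x) x = gone }.

Arguments gmul {g}. Arguments ginv {g}. Arguments gone {g}.

Definition gpow {G : group} (x : G) (z : Z) : G :=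
  match z with
  | Z0 => gone
  | Zpos q => Pos.iter (gmul x) gone q
  | Zneg q => ginv (Pos.iter (gmul x) gone q)
  end.

Definition comm {G : group} (x y : G) : G :=
  gmul (gmul (gmul (ginv x) (ginv y)) x) y.

Definition seteq {G : group} (A B : G -> Prop) := forall x, A x <-> B x.
Definition subs {G : group} (A B : G -> Prop) := forall x, A x -> B x.
Definition trivialS {G : group} (A : G -> Prop) := forall x, A x -> x = gone.

Definition subgroup {G : group} (S : G -> Prop) : Prop :=
  S gone /\ (forall x y, S x -> S y -> S (gmul x y)) /\ (forall x, S x -> S (ginv x)).

Definition gen {G : group} (l : list G) : G -> Prop :=
  fun x => forall S, subgroup S -> (forall y, In y l -> S y) -> S x.

Definition normalS {G : group} (N K : G -> Prop) : Prop :=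
  subgroup N /\ subs N K /\
  forall g x, K g -> N x -> N (gmul (gmul (ginv g) x) g).

Definition image {G : group} (f : G -> G) (A : G -> Prop) : G -> Prop :=
  fun y => exists x, A x /\ y = f x.

Definition hom_on {G K : group} (H : G -> Prop) (f : G -> K) : Prop :=
  forall x y, H x -> H y -> f (gmul x y) = gmul (f x) (f y).

Definition inj_on {G : group} (H : G -> Prop) (f : G -> G) : Prop :=
  forall x y, H x -> H y -> f x = f y -> x = y.

Definition simple_triple {G : group} (K H : G -> Prop) (f : G -> G) : Prop :=
  forall L, subs L H -> normalS L K -> subs (image f L) L -> trivialS L.

Fixpoint GHseq {G : group} (G0 H0 : G -> Prop) (f : G -> G) (k : nat)
  : (G -> Prop) * (G -> Prop) :=
  match k with
  | 0 => (G0, H0)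
  | Datatypes.S k' => let Gk1 := image f (snd (GHseq G0 H0 f k')) in
            (Gk1, fun x => H0 x /\ Gk1 x)
  end.
Definition Gk {G : group} G0 H0 (f : G -> G) k := fst (GHseq G0 H0 f k).
Definition Hk {G : group} G0 H0 (f : G -> G) k := snd (GHseq G0 H0 f k).

(* Convention: p = 0 encodes p = infinity.  Gq/Hq (Hq normal in Gq) is
   cyclic of order p (infinite cyclic if p = 0). Note (0 | m) <-> m = 0. *)
Definition quot_cyclic_order {G : group} (p : nat) (Gq Hq : G -> Prop) : Prop :=
  exists g, Gq g /\
    (forall x, Gq x -> exists m, Hq (gmul (ginv (gpow g m)) x)) /\
    (forall m, Hq (gpow g m) <-> (Z.of_nat p | m)%Z).

(* polycyclic series: G = <l_0,...,l_{m-1}> > <l_1,...> > ... > <> = 1,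
   each term normal in the previous one (factors are then cyclic). *)
Definition poly_series {G : group} (G0 : G -> Prop) (l : list G) : Prop :=
  seteq G0 (gen l) /\
  forall i, i < length l -> normalS (gen (skipn (S i) l)) (gen (skipn i l)).

Definition polycyclic {G : group} (G0 : G -> Prop) : Prop :=
  exists l, poly_series G0 l.

Definition infinite_factor {G : group} (l : list G) (i : nat) : Prop :=
  forall x m, nth_error l i = Some x -> gen (skipn (S i) l) (gpow x m) -> m = 0%Z.

Definition hirsch_length {G : group} (G0 : G -> Prop) (n : nat) : Prop :=
  exists l, poly_series G0 l /\
    exists idx : list nat, NoDup idx /\ length idx = n /\
      forall i, In i idx <-> (i < length l /\ infinite_factor l i).

Definition card_is {G : group} (G0 : G -> Prop) (N : nat) : Prop :=
  exists l : list G, NoDup l /\ length l = N /\ forall x, G0 x <-> In x l.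

Definition ssp_length {G : group} (p : nat) (G0 : G -> Prop) (n : nat) : Prop :=
  if Nat.eqb p 0 then hirsch_length G0 n else card_is G0 (p ^ n).

Definition SSP {G : group} (p : nat) (G0 H0 : G -> Prop) (f : G -> G) : Prop :=
  subgroup G0 /\ subgroup H0 /\ subs H0 G0 /\ hom_on H0 f /\ subs (image f H0) G0 /\
  polycyclic G0 /\
  (* (1) *) inj_on H0 f /\
  (* (2) *) (forall k, simple_triple (Gk G0 H0 f k) (Hk G0 H0 f k) f) /\
  (* (3) *) (forall k, normalS (Hk G0 H0 f k) (Gk G0 H0 f k) /\
                       normalS (Gk G0 H0 f (S k)) (Gk G0 H0 f k) /\
                       forall x, Gk G0 H0 f k x <->
                         exists y z, Hk G0 H0 f k y /\ Gk G0 H0 f (S k) z /\ x = gmul y z) /\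
  (* (4) *) (forall k, ~ trivialS (Gk G0 H0 f k) ->
                       quot_cyclic_order p (Gk G0 H0 f k) (Hk G0 H0 f k)).

(* canonical basis (a_1,...,a_n), 1-based indexing *)
Definition canonical_basis {G : group} (G0 H0 : G -> Prop) (f : G -> G)
  (a : nat -> G) (n : nat) : Prop :=
  (forall i, 1 <= i <= n - 1 -> H0 (a i) /\ a (S i) = f (a i)) /\
  (forall i, i <= n - 1 ->
     seteq (Gk G0 H0 f i) (gen (map a (seq (S i) (n - i)))) /\
     seteq (Hk G0 H0 f i) (gen (map a (seq (S i) (n - 1 - i))))).

Definition cutoff_point {G : group} (a : nat -> G) (n c : nat) : Prop :=
  2 <= c <= n /\ (forall i, 2 <= i <= c -> comm (a 1) (a i) = gone) /\
  (c < n -> comm (a 1) (a (S c)) <> gone).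

Definition qn (n : nat) := n / 3.
Definition rn (n : nat) := n mod 3.
Definition cnj (n j : nat) := 2 * qn n + rn n + j.

Definition nonabelian {G : group} (G0 : G -> Prop) :=
  exists x y, G0 x /\ G0 y /\ gmul x y <> gmul y x.
Definition nilclass2 {G : group} (G0 : G -> Prop) :=
  nonabelian G0 /\
  forall x y z, G0 x -> G0 y -> G0 z -> comm (comm x y) z = gone.

Inductive word := WGen (i : nat) | WOne | WMul (u v : word) | WInv (u : word).
Fixpoint weval {G : group} (b : nat -> G) (w : word) : G :=
  match w with
  | WGen i => b i | WOne => gone
  | WMul u v => gmul (weval b u) (weval b v)
  | WInv u => ginv (weval b u)
  end.
Definition wpow (w : word) (z : Z) : word :=
  match z with
  | Z0 => WOne
  | Zpos q => Pos.iter (WMul w) WOne q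
  | Zneg q => WInv (Pos.iter (WMul w) WOne q)
  end.
Definition wcomm (u v : word) : word := WMul (WMul (WMul (WInv u) (WInv v)) u) v.
Definition wprod (f : nat -> word) (l : list nat) : word :=
  fold_right (fun i acc => WMul (f i) acc) WOne l.

Definition presents {G : group} (G0 : G -> Prop) (a : nat -> G) (m : nat)
  (rel : word -> word -> Prop) : Prop :=
  seteq G0 (gen (map a (seq 1 m))) /\
  (forall u v, rel u v -> weval a u = weval a v) /\
  (forall (K : group) (b : nat -> K),
     (forall u v, rel u v -> weval b u = weval b v) ->
     exists phi : G -> K, hom_on G0 phi /\ forall i, 1 <= i <= m -> phi (a i) = b i).

Definition Rhat (p n j : nat) (e : nat -> nat -> Z) (d : nat -> Z)
  (u v : word) : Prop :=
  let q := qn n in let r := rn n in let c := cnj n j in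
  (exists t, 1 + t <= n + 1 /\ u = wpow (WGen (1 + t)) (Z.of_nat p) /\ v = WOne) \/
  (exists t i, 2 <= i <= c /\ i + t <= n + 1 /\
     u = wcomm (WGen (1 + t)) (WGen (i + t)) /\ v = WOne) \/
  (exists t k, k <= q - j - 1 /\ j + 1 <= q /\ c + 1 + k + t <= n + 1 /\
     u = wcomm (WGen (1 + t)) (WGen (c + 1 + k + t)) /\
     v = wprod (fun i => wpow (WGen (i + t)) (e k i))
               (seq (q + 2 - j) (q + r + 2 * j + k + 1 - (q + 2 - j)))) \/
  (* (iv) (only the unshifted relation has all indices <= n+1) *)
  (u = wcomm (WGen 1) (WGen (n + 1)) /\
   v = wprod (fun i => wpow (WGen i) (d i)) (seq (q + 1 - j) (c + 2 - (q + 1 - j)))).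

(* Main.v *)
Require Import Defs.
From Stdlib Require Import ZArith List Arith Znumtheory Lia ClassicalEpsilon.
Import ListNotations.
Open Scope nat_scope.

(* Write u_m = [a_1, a_m], w = [a_1, a_(n+1)] and c = c(n,j), b = q(n) + 1 - j, so
   that n + 1 = b + c and the elements a_b, ..., a_c are central in G = <a_1, ..., a_n>.
   Write w as an ordered product of powers of a_2, ..., a_n.  Conjugating the relation
   [a_1, a_i] = u_i by a_(n+1) gives, since G has class 2,
     [w, a_i] = F^(b-1)(u_(c+1))^s   for c < i <= n, s the exponent of a_b in u_i,
     [w, a_i] u_(c+1)^t = 1          for 2 <= i <= b, t the top exponent of u_(n+2-i).
   In both families the left factor [w, a_i] is, by induction on i, a power of a single
   F^d(u_(c+1)) whose exponent is an exponent of w, and powers of u_(c+1) and of its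
   images under different powers of F are independent because their last indices
   differ.  So all these exponents vanish, which gives (iii) and (iv).

   These relations put [a_i, a_m] in <a_(i+1), ..., a_(m-1)>, so in any group satisfying
   them words can be collected; as exponents in a lifting are unique (modulo p),
   this makes the relations a presentation. *)

(** * Groups and integer powers *)

Section GroupLemmas.
Context {G : group}.
Implicit Types x y z : G.

Lemma gmulVr x : gmul x (ginv x) = gone.
Proof.
  rewrite <- (gmul1l G (gmul x (ginv x))).
  rewrite <- (gmulVl G (ginv x)) at 1.
  rewrite <- gmulA, (gmulA G (ginv x)), gmulVl, gmul1l.
  apply gmulVl.
Qed.

Lemma gmul1r x : gmul x gone = x.
Proof. rewrite <- (gmulVl G x), gmulA, gmulVr. apply gmul1l. Qed.

Lemma gmulKl x y : gmul (ginv x) (gmul x y) = y.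
Proof. rewrite gmulA, gmulVl. apply gmul1l. Qed.

Lemma gmulKr x y : gmul x (gmul (ginv x) y) = y.
Proof. rewrite gmulA, gmulVr. apply gmul1l. Qed.

Lemma gmul_cancel_l x y z : gmul x y = gmul x z -> y = z.
Proof. intro E. rewrite <- (gmulKl x y), E. apply gmulKl. Qed.

Lemma gmul_cancel_r x y z : gmul y x = gmul z x -> y = z.
Proof.
  intro E. rewrite <- (gmul1r y), <- (gmul1r z), <- (gmulVr x), !gmulA.
  now rewrite E.
Qed.

Lemma ginvK x : ginv (ginv x) = x.
Proof. apply (gmul_cancel_l (ginv x)). now rewrite gmulVr, gmulVl. Qed.

Lemma ginv1 : ginv gone = @gone G.
Proof. apply (gmul_cancel_l gone). now rewrite gmulVr, gmul1l. Qed.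

Lemma ginvM x y : ginv (gmul x y) = gmul (ginv y) (ginv x).
Proof.
  apply (gmul_cancel_l (gmul x y)).
  now rewrite gmulVr, <- gmulA, gmulKr, gmulVr.
Qed.

End GroupLemmas.

#[local] Hint Rewrite <- gmulA : grp.
#[local] Hint Rewrite @gmul1l @gmul1r @gmulVl @gmulVr @gmulKl @gmulKr @ginvK
  @ginv1 @ginvM : grp.

Ltac group_simpl := autorewrite with grp.
Ltac group_eq := intros; unfold comm; group_simpl; reflexivity.

Section Powers.
Context {G : group}.
Implicit Types x y : G.

Lemma comm_eq1 x y : comm x y = gone <-> gmul x y = gmul y x.
Proof.
  split; intro E.
  - apply (gmul_cancel_l (gmul (ginv x) (ginv y))).
    transitivity (comm x y); [group_eq | rewrite E; group_eq].
  - unfold comm. rewrite <- gmulA, E. group_eq.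
Qed.

Lemma ginv_comm x y : ginv (comm x y) = comm y x.
Proof. group_eq. Qed.

Lemma commMl x y (z : G) :
  gmul (comm x z) y = gmul y (comm x z) ->
  comm (gmul x y) z = gmul (comm x z) (comm y z).
Proof.
  intro E.
  transitivity (gmul (gmul (ginv y) (gmul (comm x z) y)) (comm y z)).
  - group_eq.
  - rewrite E. group_eq.
Qed.

Lemma commMr x y (z : G) :
  gmul (comm x y) z = gmul z (comm x y) ->
  comm x (gmul y z) = gmul (comm x z) (comm x y).
Proof.
  intro E.
  transitivity (gmul (comm x z) (gmul (ginv z) (gmul (comm x y) z))).
  - group_eq.
  - rewrite E. group_eq.
Qed.

Lemma gpow0 x : gpow x 0 = gone.
Proof. reflexivity. Qed.

Lemma gpow_succ x z : gpow x (Z.succ z) = gmul x (gpow x z).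
Proof.
  (* In the negative case the iterate is inverted, which puts the factor to be cancelled at the
     wrong end; [C] moves it across. *)
  assert (C : forall q, gmul (Pos.iter (gmul x) gone q) x
                        = gmul x (Pos.iter (gmul x) gone q)).
  { intro q. induction q as [|q IH] using Pos.peano_ind.
    - simpl. group_eq.
    - rewrite Pos.iter_succ, <- gmulA, IH. reflexivity. }
  destruct z as [|q|q].
  - reflexivity.
  - replace (Z.succ (Zpos q)) with (Zpos (Pos.succ q)) by lia.
    simpl. now rewrite Pos.iter_succ.
  - induction q as [|q _] using Pos.peano_ind.
    + simpl. group_eq.
    + replace (Z.succ (Zneg (Pos.succ q))) with (Zneg q) by lia.
      simpl. rewrite Pos.iter_succ, <- C. group_eq.
Qed.

Lemma gpow_pred x z : gpow x (Z.pred z) = gmul (ginv x) (gpow x z).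
Proof.
  apply (gmul_cancel_l x). rewrite <- gpow_succ, Z.succ_pred. group_eq.
Qed.

Lemma gpow1 x : gpow x 1 = x.
Proof. simpl. apply gmul1r. Qed.

Lemma gpowD x i k : gpow x (i + k) = gmul (gpow x i) (gpow x k).
Proof.
  induction i as [|i IH|i IH] using Z.peano_ind.
  - rewrite gpow0, gmul1l. reflexivity.
  - rewrite Z.add_succ_l, !gpow_succ, IH. group_eq.
  - rewrite Z.add_pred_l, !gpow_pred, IH. group_eq.
Qed.

Lemma gpowN x i : gpow x (- i) = ginv (gpow x i).
Proof.
  apply (gmul_cancel_l (gpow x i)).
  rewrite <- gpowD, Z.add_opp_diag_r. group_eq.
Qed.

Lemma gpowM x i k : gpow x (i * k) = gpow (gpow x i) k.
Proof.
  induction k as [|k IH|k IH] using Z.peano_ind.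
  - now rewrite Z.mul_0_r.
  - rewrite Z.mul_succ_r, Z.add_comm, gpowD, IH, gpow_succ. reflexivity.
  - rewrite Z.mul_pred_r, <- Z.add_opp_r, Z.add_comm, gpowD, IH, gpow_pred, gpowN.
    reflexivity.
Qed.

Lemma gpow_gone z : gpow (@gone G) z = gone.
Proof.
  induction z as [|z IH|z IH] using Z.peano_ind.
  - reflexivity.
  - rewrite gpow_succ, IH. group_eq.
  - rewrite gpow_pred, IH. group_eq.
Qed.

Lemma gpow_dvd x (p : nat) z :
  gpow x (Z.of_nat p) = gone -> (Z.of_nat p | z)%Z -> gpow x z = gone.
Proof. intros E [k ->]. now rewrite Z.mul_comm, gpowM, E, gpow_gone. Qed.

Lemma commute_inv x y : gmul x y = gmul y x -> gmul x (ginv y) = gmul (ginv y) x.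
Proof.
  intro E. apply (gmul_cancel_l y), (gmul_cancel_r y).
  rewrite gmulKr, <- !gmulA, gmulVl, gmul1r. now symmetry.
Qed.

Lemma commute_mul x y (z : G) :
  gmul x y = gmul y x -> gmul x z = gmul z x ->
  gmul x (gmul y z) = gmul (gmul y z) x.
Proof. intros E1 E2. now rewrite gmulA, E1, <- gmulA, E2, gmulA. Qed.

Lemma commute_gpow x y z : gmul x y = gmul y x -> gmul x (gpow y z) = gmul (gpow y z) x.
Proof.
  intro E. induction z as [|z IH|z IH] using Z.peano_ind.
  - rewrite gpow0. group_eq.
  - rewrite gpow_succ. now apply commute_mul.
  - rewrite gpow_pred. apply commute_mul; auto. now apply commute_inv.
Qed.

Lemma gpow_mul x y z :
  gmul x y = gmul y x -> gpow (gmul x y) z = gmul (gpow x z) (gpow y z).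
Proof.
  intro E. induction z as [|z IH|z IH] using Z.peano_ind.
  - rewrite !gpow0. group_eq.
  - assert (C := commute_gpow y x z (eq_sym E)).
    rewrite !gpow_succ, IH, <- !gmulA, (gmulA G y), C. group_eq.
  - assert (C := commute_gpow y x z (eq_sym E)).
    assert (C' : gmul (ginv y) (gpow x z) = gmul (gpow x z) (ginv y))
      by (symmetry; apply commute_inv; auto).
    rewrite !gpow_pred, IH, E, ginvM, <- !gmulA, (gmulA G (ginv y)), C'. group_eq.
Qed.

End Powers.

(** * Generated subgroups *)

Section Generation.
Context {G : group}.
Implicit Types (S T : G -> Prop) (x y : G) (l : list G) (c : nat -> G).

Lemma gen_subgroup l : subgroup (gen l).
Proof.
  split; [|split].
  - intros S HS _. apply HS.
  - intros x y Hx Hy S HS Hl. apply HS; [apply Hx | apply Hy]; auto.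
  - intros x Hx S HS Hl. apply HS, Hx; auto.
Qed.

Lemma gen_in l x : In x l -> gen l x.
Proof. intros H S _ Hl. auto. Qed.

Lemma gen_least l S : subgroup S -> (forall y, In y l -> S y) -> subs (gen l) S.
Proof. intros HS Hl x Hx. now apply Hx. Qed.

Lemma gen_seq_in c s len i : s <= i < s + len -> gen (map c (seq s len)) (c i).
Proof. intro H. apply gen_in, in_map, in_seq. lia. Qed.

Lemma gen_seq_least c s len S :
  subgroup S -> (forall i, s <= i < s + len -> S (c i)) ->
  subs (gen (map c (seq s len))) S.
Proof.
  intros HS H. apply gen_least; auto. intros y Hy.
  apply in_map_iff in Hy. destruct Hy as [i [<- Hi]]. apply H, in_seq, Hi.
Qed.

Lemma gen_seq_mono c s len s' len' :
  s' <= s -> s + len <= s' + len' ->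
  subs (gen (map c (seq s len))) (gen (map c (seq s' len'))).
Proof.
  intros H1 H2. apply gen_seq_least; [apply gen_subgroup|].
  intros i Hi. apply gen_seq_in. lia.
Qed.

Lemma subgroup_one S : subgroup S -> S gone.
Proof. now intros [H _]. Qed.

Lemma subgroup_mul S x y : subgroup S -> S x -> S y -> S (gmul x y).
Proof. intros (_ & H & _). apply H. Qed.

Lemma subgroup_inv S x : subgroup S -> S x -> S (ginv x).
Proof. intros (_ & _ & H). apply H. Qed.

Lemma subgroup_gpow S x z : subgroup S -> S x -> S (gpow x z).
Proof.
  intros HS Hx. induction z as [|z IH|z IH] using Z.peano_ind.
  - exact (subgroup_one S HS).
  - rewrite gpow_succ. now apply subgroup_mul.
  - rewrite gpow_pred. apply subgroup_mul; auto. now apply subgroup_inv.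
Qed.

Lemma subgroup_comm S x y : subgroup S -> S x -> S y -> S (comm x y).
Proof.
  intros HS Hx Hy. unfold comm.
  repeat apply subgroup_mul; auto; now apply subgroup_inv.
Qed.

Lemma centralizer_subgroup x : subgroup (fun y => gmul x y = gmul y x).
Proof.
  split; [|split].
  - group_eq.
  - intros y z. apply commute_mul.
  - intros y. apply commute_inv.
Qed.

End Generation.

(** * Homomorphisms defined on a subgroup *)

Section Homs.
Context {G K : group} (S : G -> Prop) (f : G -> K).
Context (HS : subgroup S) (Hf : hom_on S f).

Lemma hom_one : f gone = gone.
Proof.
  apply (gmul_cancel_l (f gone)).
  rewrite <- Hf; try now apply subgroup_one. now rewrite gmul1l, gmul1r.
Qed.

Lemma hom_inv x : S x -> f (ginv x) = ginv (f x).
Proof.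
  intro Hx. apply (gmul_cancel_l (f x)).
  rewrite <- Hf; auto; [|now apply subgroup_inv].
  now rewrite !gmulVr, hom_one.
Qed.

Lemma hom_gpow x z : S x -> f (gpow x z) = gpow (f x) z.
Proof.
  intro Hx. induction z as [|z IH|z IH] using Z.peano_ind.
  - apply hom_one.
  - rewrite !gpow_succ, Hf, IH; auto. now apply subgroup_gpow.
  - rewrite !gpow_pred, Hf, IH, hom_inv; auto.
    + now apply subgroup_inv.
    + now apply subgroup_gpow.
Qed.

Lemma hom_comm x y : S x -> S y -> f (comm x y) = comm (f x) (f y).
Proof.
  intros Hx Hy. unfold comm.
  rewrite !Hf, !hom_inv; auto;
    repeat apply subgroup_mul; auto; now apply subgroup_inv.
Qed.

(** Membership in [S] is kept in the predicate because [f] is multiplicative only on [S]. *)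
Lemma preimage_subgroup (T : K -> Prop) :
  subgroup T -> subgroup (fun x => S x /\ T (f x)).
Proof.
  intro HT. split; [|split].
  - split; [now apply subgroup_one|]. rewrite hom_one. now apply subgroup_one.
  - intros x y [Hx Tx] [Hy Ty]. split; [now apply subgroup_mul|].
    rewrite Hf; auto. now apply subgroup_mul.
  - intros x [Hx Tx]. split; [now apply subgroup_inv|].
    rewrite hom_inv; auto. now apply subgroup_inv.
Qed.

End Homs.

(** * Ordered products of powers *)

(** Exponents are indexed by the index of the generator, not by its position in the list, so passing
    to a subrange keeps the same function [x]. *)
Definition gprod {G : group} (c : nat -> G) (x : nat -> Z) (l : list nat) : G :=
  fold_right (fun i acc => gmul (gpow (c i) (x i)) acc) gone l.

Section Products.
Context {G : group}.
Implicit Types (c : nat -> G) (x : nat -> Z) (l : list nat).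

Lemma gprod_app c x l1 l2 : gprod c x (l1 ++ l2) = gmul (gprod c x l1) (gprod c x l2).
Proof.
  induction l1 as [|i l1 IH]; simpl.
  - now rewrite gmul1l.
  - now rewrite IH, gmulA.
Qed.

Lemma gprod_split c x s i k :
  gprod c x (seq s (i + k)) = gmul (gprod c x (seq s i)) (gprod c x (seq (s + i) k)).
Proof. now rewrite seq_app, gprod_app. Qed.

Lemma gprod_snoc c x s len :
  gprod c x (seq s (S len)) = gmul (gprod c x (seq s len)) (gpow (c (s + len)) (x (s + len))).
Proof.
  replace (S len) with (len + 1) by lia. rewrite gprod_split. simpl.
  now rewrite gmul1r.
Qed.

Lemma gprod_ext c c' x x' l :
  (forall i, In i l -> c i = c' i /\ x i = x' i) -> gprod c x l = gprod c' x' l.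
Proof.
  induction l as [|i l IH]; intro H; simpl; auto.
  destruct (H i (or_introl eq_refl)) as [-> ->]. rewrite IH; auto.
  intros k Hk. apply H. now right.
Qed.

Lemma gprod_trivial c x l :
  (forall i, In i l -> gpow (c i) (x i) = gone) -> gprod c x l = gone.
Proof.
  induction l as [|i l IH]; intro H; simpl; auto.
  rewrite H, IH; [group_eq| |now left]. intros k Hk. apply H. now right.
Qed.

Lemma gprod_restrict c x s len s' len' :
  s <= s' -> s' + len' <= s + len ->
  (forall i, s <= i < s' -> gpow (c i) (x i) = gone) ->
  (forall i, s' + len' <= i < s + len -> gpow (c i) (x i) = gone) ->
  gprod c x (seq s len) = gprod c x (seq s' len').
Proof.
  intros H1 H2 L R.
  replace len with ((s' - s) + (len' + (s + len - (s' + len')))) by lia.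
  rewrite !gprod_split.
  replace (s + (s' - s)) with s' by lia.
  rewrite (gprod_trivial c x (seq s _)), (gprod_trivial c x (seq (s' + len') _)).
  - group_eq.
  - intros i Hi. apply in_seq in Hi. apply R. lia.
  - intros i Hi. apply in_seq in Hi. apply L. lia.
Qed.

Lemma gprod_single c x s len i0 :
  s <= i0 < s + len ->
  (forall i, s <= i < s + len -> i <> i0 -> gpow (c i) (x i) = gone) ->
  gprod c x (seq s len) = gpow (c i0) (x i0).
Proof.
  intros H E. rewrite (gprod_restrict c x s len i0 1).
  - simpl. apply gmul1r.
  - lia.
  - lia.
  - intros i Hi. apply E; lia.
  - intros i Hi. apply E; lia.
Qed.

Lemma gprod_in (T : G -> Prop) c x l :
  subgroup T -> (forall i, In i l -> T (c i)) -> T (gprod c x l).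
Proof.
  intros HT. induction l as [|i l IH]; intro H; simpl.
  - now apply subgroup_one.
  - apply subgroup_mul; auto.
    + apply subgroup_gpow; auto. apply H. now left.
    + apply IH. intros k Hk. apply H. now right.
Qed.

Lemma commute_gprod (g : G) c x l :
  (forall i, In i l -> gmul g (c i) = gmul (c i) g) ->
  gmul g (gprod c x l) = gmul (gprod c x l) g.
Proof. exact (gprod_in _ c x l (centralizer_subgroup g)). Qed.

End Products.

Lemma hom_gprod {G K : group} (T : G -> Prop) (f : G -> K) c x l :
  subgroup T -> hom_on T f -> (forall i, In i l -> T (c i)) ->
  f (gprod c x l) = gprod (fun i => f (c i)) x l.
Proof.
  intros HT Hf. induction l as [|i l IH]; intro H; simpl.
  - now apply (hom_one T).
  - assert (Hi : T (c i)) by (apply H; now left).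
    assert (Hl : forall k, In k l -> T (c k)) by (intros k Hk; apply H; now right).
    rewrite Hf, (hom_gpow T), IH; auto.
    + now apply subgroup_gpow.
    + now apply gprod_in.
Qed.

Lemma weval_wpow {G : group} (b : nat -> G) w z :
  weval b (wpow w z) = gpow (weval b w) z.
Proof.
  assert (E : forall q, weval b (Pos.iter (WMul w) WOne q)
                        = Pos.iter (gmul (weval b w)) gone q).
  { intro q. induction q as [|q IH] using Pos.peano_ind; [reflexivity|].
    rewrite !Pos.iter_succ. simpl. now rewrite IH. }
  destruct z; simpl; [reflexivity| |]; now rewrite E.
Qed.

Lemma weval_wprod {G : group} (b : nat -> G) g x l :
  weval b (wprod (fun i => wpow (WGen (g i)) (x i)) l) = gprod (fun i => b (g i)) x l.
Proof.
  induction l as [|i l IH]; simpl; auto. now rewrite weval_wpow, IH.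
Qed.

(** * Collection *)

Section Collection.
Context {K : group} (c : nat -> K) (N : nat).
Context (Hc : forall i m, 1 <= i -> i < m -> m <= N ->
  gen (map c (seq (S i) (m - 1 - i))) (comm (c i) (c m))).

(** Induction on [len]: conjugation multiplies the last generator [c m] by the inverse of
    [comm (c s) (c m)], or by a conjugate of that commutator, and the commutator lies in the span of
    the earlier generators. Both directions are proved, since negative powers of [c s] also
    conjugate. *)
Lemma conj_gen s len h :
  1 <= s -> s + len <= N -> gen (map c (seq (S s) len)) h ->
  gen (map c (seq (S s) len)) (gmul (gmul (ginv (c s)) h) (c s)) /\
  gen (map c (seq (S s) len)) (gmul (gmul (c s) h) (ginv (c s))).
Proof.
  intros H1. revert h. induction len as [|len IH]; intros h H2 Hh.
  - assert (E : h = gone).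
    { apply (Hh (fun x => x = gone)); [|now intros].
      repeat split; intros; subst; group_eq. }
    subst h. split; group_simpl; apply subgroup_one, gen_subgroup.
  - set (T := gen (map c (seq (S s) (S len)))).
    assert (HT : subgroup T) by apply gen_subgroup.
    assert (Sub : subs (gen (map c (seq (S s) len))) T)
      by (apply gen_seq_mono; lia).
    revert h Hh. apply gen_seq_least.
    + split; [|split].
      * split; group_simpl; now apply subgroup_one.
      * intros x y [X1 X2] [Y1 Y2]. split.
        -- replace (gmul (gmul (ginv (c s)) (gmul x y)) (c s)) with
             (gmul (gmul (gmul (ginv (c s)) x) (c s)) (gmul (gmul (ginv (c s)) y) (c s)))
             by group_eq.
           now apply subgroup_mul.
        -- replace (gmul (gmul (c s) (gmul x y)) (ginv (c s))) with
             (gmul (gmul (gmul (c s) x) (ginv (c s))) (gmul (gmul (c s) y) (ginv (c s))))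
             by group_eq.
           now apply subgroup_mul.
      * intros x [X1 X2]. split.
        -- replace (gmul (gmul (ginv (c s)) (ginv x)) (c s)) with
             (ginv (gmul (gmul (ginv (c s)) x) (c s))) by group_eq.
           now apply subgroup_inv.
        -- replace (gmul (gmul (c s) (ginv x)) (ginv (c s))) with
             (ginv (gmul (gmul (c s) x) (ginv (c s)))) by group_eq.
           now apply subgroup_inv.
    + intros i Hi. destruct (Nat.eq_dec i (S s + len)) as [->|Ne].
      * assert (C := Hc s (S s + len) H1 ltac:(lia) ltac:(lia)).
        replace (S s + len - 1 - s) with len in C by lia.
        set (m := S s + len) in *.
        assert (Tm : T (c m)) by (apply gen_seq_in; lia).
        destruct (IH _ ltac:(lia) C) as [_ C2].
        split.
        -- replace (gmul (gmul (ginv (c s)) (c m)) (c s)) with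
             (gmul (c m) (ginv (comm (c s) (c m)))) by group_eq.
           apply subgroup_mul; auto. apply subgroup_inv; auto.
        -- replace (gmul (gmul (c s) (c m)) (ginv (c s))) with
             (gmul (c m) (gmul (gmul (c s) (comm (c s) (c m))) (ginv (c s))))
             by group_eq.
           apply subgroup_mul; auto.
      * destruct (IH (c i) ltac:(lia)) as [C1 C2]; [apply gen_seq_in; lia|].
        split; apply Sub; assumption.
Qed.

Lemma conj_gen_gpow s len h z :
  1 <= s -> s + len <= N -> gen (map c (seq (S s) len)) h ->
  gen (map c (seq (S s) len)) (gmul (gmul (ginv (gpow (c s) z)) h) (gpow (c s) z)).
Proof.
  intros H1 H2. revert h. induction z as [|z IH|z IH] using Z.peano_ind; intros h Hh.
  - rewrite gpow0. group_simpl. exact Hh.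
  - rewrite gpow_succ.
    destruct (conj_gen s len h H1 H2 Hh) as [C _]. apply IH in C.
    eapply eq_ind; [exact C|]. group_eq.
  - rewrite gpow_pred.
    destruct (conj_gen s len h H1 H2 Hh) as [_ C]. apply IH in C.
    eapply eq_ind; [exact C|]. group_eq.
Qed.

(** Powers of [c s] normalize the span [R] of the later generators, so the products of a power of
    [c s] and an element of [R] form a subgroup containing all generators; the factor in [R] is
    collected by induction. *)
Lemma collect s len h :
  1 <= s -> s + len <= S N -> gen (map c (seq s len)) h ->
  exists x, h = gprod c x (seq s len).
Proof.
  revert s h. induction len as [|len IH]; intros s h H1 H2 Hh.
  - exists (fun _ => 0%Z). apply (Hh (fun x => x = gone)); [|now intros].
    repeat split; intros; subst; group_eq.
  - set (R := gen (map c (seq (S s) len))).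
    assert (HR : subgroup R) by apply gen_subgroup.
    assert (E : exists z h', R h' /\ h = gmul (gpow (c s) z) h').
    { assert (NR : forall x z, R x -> R (gmul (gmul (ginv (gpow (c s) z)) x) (gpow (c s) z)))
        by (intros; apply conj_gen_gpow; auto; lia).
      revert h Hh. apply gen_seq_least.
      - split; [|split].
        + exists 0%Z, gone. split; [now apply subgroup_one|]. rewrite gpow0. group_eq.
        + intros x y (z1 & h1 & R1 & ->) (z2 & h2 & R2 & ->).
          exists (z1 + z2)%Z. eexists. split.
          * apply (subgroup_mul R); [exact HR| |exact R2].
            apply (NR h1 z2), R1.
          * rewrite gpowD. group_eq.
        + intros x (z1 & h1 & R1 & ->).
          exists (- z1)%Z. eexists. split.
          * apply (NR (ginv h1) (- z1)%Z). now apply subgroup_inv.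
          * rewrite gpowN. group_eq.
      - intros i Hi. destruct (Nat.eq_dec i s) as [->|Ne].
        + exists 1%Z, gone. split; [now apply subgroup_one|]. rewrite gpow1. group_eq.
        + exists 0%Z, (c i). split; [apply gen_seq_in; lia|]. rewrite gpow0. group_eq. }
    destruct E as (z & h' & Hh' & ->).
    destruct (IH (S s) h' ltac:(lia) ltac:(lia) Hh') as [x ->].
    exists (fun i => if Nat.eqb i s then z else x i).
    simpl. rewrite Nat.eqb_refl. f_equal.
    apply gprod_ext. intros i Hi. apply in_seq in Hi.
    destruct (Nat.eqb_spec i s); [lia|auto].
Qed.

End Collection.

(** * Presentations by collection *)

Definition prod_group (G K : group) : group.
Proof.
  refine (@Group (G * K)%type
    (fun x y => (gmul (fst x) (fst y), gmul (snd x) (snd y)))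
    (fun x => (ginv (fst x), ginv (snd x))) (gone, gone) _ _ _).
  - intros x y z. simpl. now rewrite !gmulA.
  - intros [x y]. simpl. now rewrite !gmul1l.
  - intros x. simpl. now rewrite !gmulVl.
Defined.

Lemma weval_prod (G K : group) (a : nat -> G) (b : nat -> K) w :
  weval (G := prod_group G K) (fun i => (a i, b i)) w = (weval a w, weval b w).
Proof.
  induction w as [i| |u IHu v IHv|u IHu]; simpl; auto.
  - now rewrite IHu, IHv.
  - now rewrite IHu.
Qed.

(** The consequences of [rel] are required in every group so that they can be used in the product of
    [G] with the target [K]; uniqueness of exponents is needed in [G] only. *)
Lemma presents_of_collection {G : group} (a : nat -> G) (p N : nat)
  (rel : word -> word -> Prop) :
  (forall x, gen (map a (seq 1 N)) x) ->
  (forall u v, rel u v -> weval a u = weval a v) ->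
  (forall x, gprod a x (seq 1 N) = gone ->
     forall i, 1 <= i <= N -> (Z.of_nat p | x i)%Z) ->
  (forall (K : group) (c : nat -> K),
     (forall u v, rel u v -> weval c u = weval c v) ->
     (forall i, 1 <= i <= N -> gpow (c i) (Z.of_nat p) = gone) /\
     (forall i m, 1 <= i -> i < m -> m <= N ->
        gen (map c (seq (S i) (m - 1 - i))) (comm (c i) (c m)))) ->
  presents (fun _ => True) a N rel.
Proof.
  intros Hgen Hrel Huniq Hcol. split; [|split; [exact Hrel|]].
  { intro x. split; auto. }
  intros K b Hb.
  (* The subgroup of the product generated by the pairs [(a i, b i)] is the
     graph of the homomorphism. *)
  set (P := prod_group G K). set (c := (fun i => (a i, b i)) : nat -> P).
  destruct (Hcol P c) as [Hp Hc].
  { intros u v R. unfold c, P. rewrite !weval_prod. f_equal; auto. }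
  set (D := gen (map c (seq 1 N))).
  assert (HD : subgroup D) by apply gen_subgroup.
  assert (Hfst : hom_on (fun _ : P => True) (fun z : P => fst z))
    by (intros u v _ _; reflexivity).
  (* Collect [(gone, y)] in the product. The first coordinate forces all exponents to be multiples
     of [p], and then the power relations kill the whole product. *)
  assert (Ker : forall y, D (gone, y) -> y = gone).
  { intros y Hy. destruct (collect c N Hc 1 N (gone, y)) as [x E]; auto.
    assert (E1 : gprod a x (seq 1 N) = gone).
    { apply (f_equal fst) in E. simpl in E. rewrite E.
      symmetry. apply (hom_gprod (fun _ : P => True) (fun z : P => fst z) c); auto.
      repeat split. }
    assert (E2 : gprod c x (seq 1 N) = gone).
    { apply gprod_trivial. intros i Hi. apply in_seq in Hi.
      apply gpow_dvd with p; [apply Hp|apply Huniq]; auto; lia. }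
    rewrite E2 in E. now injection E. }
  assert (Ex : forall x, exists y, D (x, y)).
  { intro x. generalize (Hgen x). revert x. apply gen_seq_least.
    - split; [|split].
      + exists gone. now apply (subgroup_one D).
      + intros x x' [y Hy] [y' Hy']. exists (gmul y y').
        exact (subgroup_mul D _ _ HD Hy Hy').
      + intros x [y Hy]. exists (ginv y). exact (subgroup_inv D _ HD Hy).
    - intros i Hi. exists (b i). apply (gen_seq_in c). lia. }
  assert (Uniq : forall x y y', D (x, y) -> D (x, y') -> y = y').
  { intros x y y' Hy Hy'. apply (gmul_cancel_l (ginv y')).
    rewrite gmulVl. apply Ker.
    assert (M := subgroup_mul D _ _ HD (subgroup_inv D _ HD Hy') Hy).
    simpl in M. rewrite gmulVl in M. exact M. }
  destruct (choice _ Ex) as [phi Hphi].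
  exists phi. split.
  - intros x y _ _. apply (Uniq (gmul x y)); auto.
    exact (subgroup_mul D _ _ HD (Hphi x) (Hphi y)).
  - intros i Hi. apply (Uniq (a i)); auto. apply (gen_seq_in c). lia.
Qed.

(** * Relations in a lifting *)

Definition span {G : group} (a : nat -> G) (m : nat) : G -> Prop :=
  gen (map a (seq 1 m)).

Lemma span_subgroup {G : group} (a : nat -> G) m : subgroup (span a m).
Proof. apply gen_subgroup. Qed.

Lemma span_in {G : group} (a : nat -> G) m i : 1 <= i <= m -> span a m (a i).
Proof. intro H. apply gen_seq_in. lia. Qed.

Lemma span_mono {G : group} (a : nat -> G) m m' :
  m <= m' -> subs (span a m) (span a m').
Proof. intro H. apply gen_seq_mono; lia. Qed.

Lemma span_gprod {G : group} (a : nat -> G) x s len t m :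
  1 <= s + t -> s + len + t <= S m -> span a m (gprod (fun i => a (i + t)) x (seq s len)).
Proof.
  intros H1 H2. apply gprod_in; [apply span_subgroup|].
  intros i Hi. apply in_seq in Hi. apply span_in. lia.
Qed.

(** Divisibility by 0 means being 0, so for [p = 0] this is the absence of zero divisors in the
    integers; finite and infinite [p] can then be treated together. *)
Lemma prime_or_zero_mult (p : nat) (y z : Z) :
  p = 0 \/ prime (Z.of_nat p) -> ~ (Z.of_nat p | y)%Z ->
  (Z.of_nat p | y * z)%Z -> (Z.of_nat p | z)%Z.
Proof.
  intros [->|Hp] Hy H.
  - simpl in *. apply Z.divide_0_l in H. apply Z.mul_eq_0 in H.
    destruct H as [->| ->]; [|apply Z.divide_0_r].
    elim Hy. apply Z.divide_0_r.
  - destruct (prime_mult _ Hp _ _ H); tauto.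
Qed.

Section Lifting.
Context {G : group} (F : G -> G) (a : nat -> G) (n : nat)
  (homF : hom_on (span a n) F)
  (Fa : forall i, 1 <= i <= n -> F (a i) = a (S i)).

Let span_n : subgroup (span a n) := span_subgroup a n.

Lemma F_span m x : m <= n -> span a m x -> span a (S m) (F x).
Proof.
  intros Hm Hx.
  enough (H : span a n x /\ span a (S m) (F x)) by apply H.
  revert x Hx. apply gen_seq_least.
  - apply preimage_subgroup; auto. apply span_subgroup.
  - intros i Hi. split; [apply span_in; lia|].
    rewrite Fa; [|lia]. apply span_in. lia.
Qed.

(** Apply [F] once for each unit of [t]. The bounds keep all indices at most [n] before each
    application, so [a (S n)] can occur only in the result. *)
Lemma comm_shift t m s len x :
  1 <= m -> 1 <= s -> m + t <= S n -> s + len + t <= n + 2 ->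
  comm (a 1) (a m) = gprod a x (seq s len) ->
  comm (a (1 + t)) (a (m + t)) = gprod (fun i => a (i + t)) x (seq s len).
Proof.
  intros H1 H2. induction t as [|t IH]; intros H3 H4 E.
  - rewrite !Nat.add_0_r, E. apply gprod_ext. intros i _. now rewrite Nat.add_0_r.
  - replace (1 + S t) with (S (1 + t)) by lia.
    replace (m + S t) with (S (m + t)) by lia.
    rewrite <- (Fa (1 + t)), <- (Fa (m + t)) by lia.
    rewrite <- (hom_comm (span a n) F), IH; auto; try lia; try (apply span_in; lia).
    rewrite (hom_gprod (span a n)); auto.
    + apply gprod_ext. intros i Hi. apply in_seq in Hi.
      rewrite Fa by lia. now replace (i + S t) with (S (i + t)) by lia.
    + intros i Hi. apply in_seq in Hi. apply span_in. lia.
Qed.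

Section Near.
Context (c : nat) (comm_near : forall i, 2 <= i <= c -> comm (a 1) (a i) = gone).

Lemma commute_near i m :
  1 <= i <= S n -> 1 <= m <= S n -> m < i + c -> i < m + c ->
  gmul (a i) (a m) = gmul (a m) (a i).
Proof.
  assert (L : forall i m, 1 <= i -> i < m -> m <= S n -> m < i + c ->
    gmul (a i) (a m) = gmul (a m) (a i)).
  { clear i m. intros i m H1 H2 H3 H4. apply comm_eq1.
    replace i with (1 + (i - 1)) by lia.
    replace (a m) with (a ((m - (i - 1)) + (i - 1))) by (f_equal; lia).
    (* A product of length 0 stands for the identity. *)
    apply (comm_shift (i - 1) (m - (i - 1)) 1 0 (fun _ => 0%Z)); try lia.
    apply comm_near. lia. }
  intros H1 H2 H3 H4. destruct (lt_eq_lt_dec i m) as [[H|H]|H].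
  - apply L; lia.
  - now subst.
  - symmetry. apply L; lia.
Qed.

End Near.

(** * Uniqueness of exponents modulo p in a lifting *)

Context (p : nat) (n_pos : 1 <= n)
  (powp : forall i, 1 <= i <= n -> gpow (a i) (Z.of_nat p) = gone).

Lemma powp_last i : 1 <= i <= S n -> gpow (a i) (Z.of_nat p) = gone.
Proof.
  intro Hi. destruct (Nat.eq_dec i (S n)) as [->|Ne]; [|apply powp; lia].
  rewrite <- Fa, <- (hom_gpow (span a n) F), powp; auto; try lia.
  - now apply (hom_one (span a n)).
  - apply span_in. lia.
Qed.

Lemma gpow_a_dvd i z : 1 <= i <= S n -> (Z.of_nat p | z)%Z -> gpow (a i) z = gone.
Proof. intro Hi. apply gpow_dvd. now apply powp_last. Qed.

Context (ordn : forall z, span a n (gpow (a (S n)) z) -> (Z.of_nat p | z)%Z).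

(** Applying [F] [d] times turns the hypothesis into one on [a (S n)] and [span a n], where [ordn]
    decides. *)
Lemma dvd_of_gpow_span d m z :
  m + d = n -> span a m (gpow (a (S m)) z) -> (Z.of_nat p | z)%Z.
Proof.
  revert m. induction d as [|d IH]; intros m E H.
  - replace m with n in H by lia. auto.
  - apply (IH (S m)); [lia|].
    rewrite <- Fa, <- (hom_gpow (span a n) F); auto; try lia.
    + apply F_span; auto. lia.
    + apply span_in. lia.
Qed.

(** The last factor is the inverse of an element spanned by the earlier generators, so its exponent
    is a multiple of [p]; it drops out and the argument descends. *)
Lemma exponents_dvd m x :
  m <= S n -> gprod a x (seq 1 m) = gone ->
  forall i, 1 <= i <= m -> (Z.of_nat p | x i)%Z.
Proof.
  induction m as [|m IH]; intros Hm E i Hi; [lia|].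
  rewrite gprod_snoc in E. change (1 + m) with (S m) in E.
  assert (D : (Z.of_nat p | x (S m))%Z).
  { apply (dvd_of_gpow_span (n - m) m); [lia|].
    replace (gpow (a (S m)) (x (S m))) with (ginv (gprod a x (seq 1 m))).
    - apply subgroup_inv; [apply span_subgroup|].
      apply gprod_in; [apply span_subgroup|].
      intros k Hk. apply in_seq in Hk. apply span_in. lia.
    - apply (gmul_cancel_l (gprod a x (seq 1 m))). now rewrite E, gmulVr. }
  rewrite gpow_a_dvd, gmul1r in E; auto; [|lia].
  destruct (Nat.eq_dec i (S m)) as [->|Ne]; auto.
  apply IH; auto; lia.
Qed.

(* In the notation of the theorem [b = q(n) + 1 - j] and [c = c(n,j)]; then
   [a_b, ..., a_c] are central in [<a_1, ..., a_n>] and the commutator of [a_1]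
   and [a_m] lies in [<a_b, ..., a_(m+1-b)>]. *)
Context (b c : nat) (Hp : p = 0 \/ prime (Z.of_nat p))
  (Hn : n + 1 = b + c) (Hb : 2 <= b) (Hbc : 2 * b <= c + 2)
  (normA : forall g x, span a n x -> span a n (gmul (gmul (ginv g) x) g))
  (comm_last : gen (map a (seq 2 (n - 1))) (comm (a 1) (a (S n))))
  (class2 : forall x y z, span a n x -> span a n y -> span a n z ->
     comm (comm x y) z = gone)
  (comm_near : forall i, 2 <= i <= c -> comm (a 1) (a i) = gone)
  (comm_far : forall t m, c < m -> m + t <= n ->
     gen (map a (seq (b + t) (m + 2 - 2 * b))) (comm (a (1 + t)) (a (m + t))))
  (comm_neq1 : comm (a 1) (a (S c)) <> gone).

(** * Commutator calculus in the class-2 subgroup *)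

Lemma a_central l z :
  b <= l <= c -> span a n z -> gmul (a l) z = gmul z (a l).
Proof.
  intro Hl. apply (gen_seq_least a 1 n _ (centralizer_subgroup (a l))).
  intros i Hi. apply (commute_near c); auto; lia.
Qed.

Lemma comm_central x y z :
  span a n x -> span a n y -> span a n z ->
  gmul (comm x y) z = gmul z (comm x y).
Proof. intros. apply comm_eq1. auto. Qed.

(** Class 2 makes the commutator multiplicative in each argument, so the general lemmas on
    homomorphisms apply to it. *)
Lemma hom_comm_l g : span a n g -> hom_on (span a n) (fun x => comm x g).
Proof. intros Hg x y Hx Hy. apply commMl. now apply comm_central. Qed.

Lemma hom_comm_r g : span a n g -> hom_on (span a n) (fun x => comm g x).
Proof.
  intros Hg x y Hx Hy. rewrite commMr; [|now apply comm_central].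
  apply comm_central; auto. now apply subgroup_comm.
Qed.

Lemma comm_below i m : 1 <= i -> i < m -> m <= n ->
  gen (map a (seq (S i) (m - 1 - i))) (comm (a i) (a m)).
Proof.
  intros H1 H2 H3. destruct (le_lt_dec (i + c) m) as [H|H].
  - assert (R := comm_far (i - 1) (m - (i - 1)) ltac:(lia) ltac:(lia)).
    replace (1 + (i - 1)) with i in R by lia.
    replace (m - (i - 1) + (i - 1)) with m in R by lia.
    revert R. apply gen_seq_mono; lia.
  - replace (comm (a i) (a m)) with (@gone G).
    + apply subgroup_one, gen_subgroup.
    + symmetry. apply comm_eq1, (commute_near c); auto; lia.
Qed.

Lemma comm_far_exponents m :
  c < m <= n -> exists y, comm (a 1) (a m) = gprod a y (seq b (m + 2 - 2 * b)).
Proof.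
  intro Hm. apply (collect a n comm_below); try lia.
  assert (R := comm_far 0 m ltac:(lia) ltac:(lia)).
  now rewrite !Nat.add_0_r in R.
Qed.

(* [U d] is the image under [F^d] of the first nontrivial commutator. *)
Let U d := comm (a (1 + d)) (a (S c + d)).

(** For [d = b - 1] the second entry of [U d] is [a (S n)], outside the range of bilinearity; hence
    only [d = 0] is treated directly and [F] carries it to larger [d]. *)
Lemma U_gpow_dvd d z : d <= b - 1 -> (Z.of_nat p | z)%Z -> gpow (U d) z = gone.
Proof.
  unfold U. induction d as [|d IH]; intros Hd D.
  - rewrite !Nat.add_0_r.
    rewrite <- (hom_gpow (span a n) (fun x => comm x (a (S c))));
      auto; try (apply hom_comm_l); try (apply span_in; lia).
    rewrite gpow_a_dvd by (auto; lia). group_eq.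
  - replace (1 + S d) with (S (1 + d)) by lia.
    replace (S c + S d) with (S (S c + d)) by lia.
    rewrite <- (Fa (1 + d)), <- (Fa (S c + d)) by lia.
    assert (H1 : span a n (a (1 + d))) by (apply span_in; lia).
    assert (H2 : span a n (a (S c + d))) by (apply span_in; lia).
    rewrite <- (hom_comm (span a n) F), <- (hom_gpow (span a n) F); auto.
    + rewrite IH; auto; [|lia]. now apply (hom_one (span a n)).
    + now apply subgroup_comm.
Qed.

(** [T] is the last index whose exponent is not a multiple of [p]. It depends on the exponents
    alone, so one [T] serves all shifts [d]. *)
Lemma last_exponent y s len :
  1 <= s -> s + len <= n + 2 -> gprod a y (seq s len) <> gone ->
  exists T, s <= T < s + len /\ ~ (Z.of_nat p | y T)%Z /\
    forall d, s + len + d <= n + 2 ->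
      gprod (fun i => a (i + d)) y (seq s len)
      = gmul (gprod (fun i => a (i + d)) y (seq s (T - s))) (gpow (a (T + d)) (y T)).
Proof.
  intro Hs. induction len as [|len IH]; intros Hl Ne; [now elim Ne|].
  destruct (Zdivide_dec (Z.of_nat p) (y (s + len))) as [D|D].
  - rewrite gprod_snoc, gpow_a_dvd, gmul1r in Ne; auto; [|lia].
    destruct (IH ltac:(lia) Ne) as (T & HT & DT & E).
    exists T. split; [lia|]. split; auto. intros d Hd.
    rewrite gprod_snoc, gpow_a_dvd, gmul1r; auto; [|lia]. apply E. lia.
  - exists (s + len). split; [lia|]. split; auto. intros d Hd.
    rewrite gprod_snoc. now replace (s + len - s) with len by lia.
Qed.

(* [U d] has last index exactly [T + d], so powers of different [U d] are
   independent. *)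
Lemma U_last_index : exists T, forall d, d <= b - 1 ->
  span a (T + d) (U d) /\
  forall z, span a (T + d - 1) (gpow (U d) z) -> (Z.of_nat p | z)%Z.
Proof.
  destruct (comm_far_exponents (S c) ltac:(lia)) as [y E].
  destruct (last_exponent y b (S c + 2 - 2 * b)) as (T & HT & DT & ET); try lia.
  { now rewrite <- E. }
  exists T. intros d Hd.
  assert (EU : U d = gmul (gprod (fun i => a (i + d)) y (seq b (T - b)))
                          (gpow (a (T + d)) (y T))).
  { unfold U. rewrite <- ET by lia. apply comm_shift; auto; lia. }
  set (h := gprod _ _ _) in EU.
  assert (Hh : span a (T + d - 1) h) by (apply span_gprod; lia).
  assert (C : gmul h (a (T + d)) = gmul (a (T + d)) h).
  { symmetry. apply commute_gprod. intros i Hi. apply in_seq in Hi. apply (commute_near c); auto; lia. }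
  split.
  - rewrite EU. apply subgroup_mul; [apply span_subgroup| |].
    + revert Hh. apply span_mono. lia.
    + apply subgroup_gpow; [apply span_subgroup|]. apply span_in. lia.
  (* As [h] commutes with [a (T + d)], removing the power of [h] from that of [U d] leaves
     [a (T + d)] to the power [y T * z] in the span of lower generators; [p] does not divide
     [y T]. *)
  - intros z Hz. apply (prime_or_zero_mult p (y T)); auto.
    apply (dvd_of_gpow_span (n - (T + d - 1)) (T + d - 1)); [lia|].
    replace (S (T + d - 1)) with (T + d) by lia.
    rewrite gpowM.
    replace (gpow (gpow (a (T + d)) (y T)) z) with (gmul (ginv (gpow h z)) (gpow (U d) z)).
    + apply subgroup_mul; auto; [apply span_subgroup|].
      apply subgroup_inv; [apply span_subgroup|].
      apply subgroup_gpow; auto. apply span_subgroup.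
    + rewrite EU, gpow_mul, gmulKl; auto. now apply commute_gpow.
Qed.

Lemma U_independent d d' z z' :
  d < d' <= b - 1 -> gpow (U d) z = gpow (U d') z' ->
  (Z.of_nat p | z)%Z /\ (Z.of_nat p | z')%Z.
Proof.
  intros Hd E. destruct U_last_index as [T HT].
  assert (D' : (Z.of_nat p | z')%Z).
  { apply (HT d'); [lia|]. rewrite <- E.
    apply (span_mono a (T + d)); [lia|].
    apply subgroup_gpow; [apply span_subgroup|]. apply HT. lia. }
  split; auto. apply (HT d); [lia|].
  rewrite E, U_gpow_dvd; auto; [|lia]. apply subgroup_one, span_subgroup.
Qed.

(** * Conjugation of the relations of G by the new generator *)

Let w := comm (a 1) (a (S n)).

Lemma w_span : span a n w.
Proof. revert comm_last. apply gen_seq_mono; lia. Qed.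

Let conj x := gmul (gmul (ginv (a (S n))) x) (a (S n)).

Lemma hom_conj : hom_on (fun _ => True) conj.
Proof. intros x y _ _. unfold conj. group_eq. Qed.

Lemma conj_fix x : gmul (a (S n)) x = gmul x (a (S n)) -> conj x = x.
Proof. intro E. unfold conj. rewrite <- gmulA, <- E. group_eq. Qed.

Lemma conj_eq x : conj x = gmul x (comm x (a (S n))).
Proof. unfold conj. group_eq. Qed.

Lemma comm_last_span x : span a n x -> span a n (comm x (a (S n))).
Proof.
  intro Hx. replace (comm x (a (S n))) with (gmul (ginv x) (conj x)).
  - apply subgroup_mul; auto. now apply subgroup_inv. now apply normA.
  - rewrite conj_eq. group_eq.
Qed.

(* Conjugate the commutator of [a_1] and [a_i] by [a_(n+1)]; [a_b] is the only factor
   that moves. *)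
Lemma comm_w_far i y :
  c < i <= n -> comm (a 1) (a i) = gprod a y (seq b (i + 2 - 2 * b)) ->
  comm w (a i) = gpow (U (b - 1)) (y b).
Proof.
  intros Hi E.
  assert (sub_all : subgroup (fun _ : G => True)) by (repeat split).
  set (v := U (b - 1)).
  assert (Hv : v = comm (a b) (a (S n))).
  { unfold v, U. f_equal; f_equal; lia. }
  assert (Sv : span a n v) by (rewrite Hv; apply comm_last_span, span_in; lia).
  assert (Sa : forall k, 1 <= k <= n -> span a n (a k)) by (intros; now apply span_in).
  assert (L : conj (comm (a 1) (a i)) = gmul (comm (a 1) (a i)) (comm w (a i))).
  { rewrite (hom_comm (fun _ => True) conj sub_all hom_conj); auto.
    rewrite (conj_fix (a i)), conj_eq by (apply (commute_near c); auto; lia).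
    apply hom_comm_l; auto; try (apply Sa; lia). apply w_span. }
  assert (R : conj (comm (a 1) (a i)) = gmul (gpow v (y b)) (comm (a 1) (a i))).
  { rewrite E. replace (i + 2 - 2 * b) with (S (i + 1 - 2 * b)) by lia. simpl.
    rewrite hom_conj, (hom_gpow (fun _ => True) conj sub_all hom_conj); auto.
    rewrite (conj_fix (gprod _ _ _)), conj_eq, <- Hv.
    - assert (C := a_central b v ltac:(lia) Sv).
      rewrite gpow_mul, gmulA by auto. f_equal.
      symmetry. apply commute_gpow. symmetry. now apply commute_gpow.
    - apply commute_gprod. intros k Hk. apply in_seq in Hk. apply (commute_near c); auto; lia. }
  apply (gmul_cancel_l (comm (a 1) (a i))). rewrite <- L, R.
  symmetry. apply comm_central; try (apply Sa; lia).
  now apply subgroup_gpow.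
Qed.

(** Conjugating [comm (a 1) (a i) = gone] by [a (S n)] replaces [a 1] by [a 1] times [w] and [a i]
    by [a i] times [v]. Of the four commutators in the bilinear expansion, those of [a 1] with [a i]
    and of [w] with [v] vanish. *)
Lemma comm_w_near i y :
  2 <= i <= b ->
  comm (a 1) (a (n + 2 - i)) = gprod a y (seq b (n + 2 - i + 2 - 2 * b)) ->
  comm w (a (S c)) = gone ->
  gmul (gpow (U 0) (y (n + 2 - i + 1 - b))) (comm w (a i)) = gone.
Proof.
  intros Hi E Hw.
  assert (sub_all : subgroup (fun _ : G => True)) by (repeat split).
  assert (Sa : forall k, 1 <= k <= n -> span a n (a k)) by (intros; now apply span_in).
  assert (Sw := w_span).
  set (v := comm (a i) (a (S n))).
  assert (Sv : span a n v) by (apply comm_last_span, Sa; lia).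
  (* [v] is the image under the power [i - 1] of [F] of the commutator of [a 1] with
     [a (n + 2 - i)]. *)
  assert (Ev : v = gprod (fun l => a (l + (i - 1))) y (seq b (n + 2 - i + 2 - 2 * b))).
  { rewrite <- (comm_shift (i - 1) (n + 2 - i)); auto; try lia.
    unfold v. f_equal; f_equal; lia. }
  assert (In_n : forall l, In l (seq b (n + 2 - i + 2 - 2 * b)) ->
            span a n (a (l + (i - 1)))).
  { intros l Hl. apply in_seq in Hl. apply Sa. lia. }
  (* The shifted indices run from [b + i - 1] to [S c]: all factors but [a (S c)] are central in
     [span a n], and [Hw] handles that one. *)
  assert (Wv : comm w v = gone).
  { rewrite Ev, (hom_gprod (span a n) (fun x => comm w x)); auto;
      [|now apply hom_comm_r].
    apply gprod_trivial. intros l Hl. apply in_seq in Hl.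
    destruct (Nat.eq_dec (l + (i - 1)) (S c)) as [->|Ne].
    - rewrite Hw. apply gpow_gone.
    - replace (comm w (a (l + (i - 1)))) with (@gone G); [apply gpow_gone|].
      symmetry. apply comm_eq1. symmetry. apply a_central; auto. lia. }
  (* Only the top factor, a power of [a (S c)], can fail to commute with [a 1]. *)
  assert (Av : comm (a 1) v = gpow (U 0) (y (n + 2 - i + 1 - b))).
  { rewrite Ev, (hom_gprod (span a n) (fun x => comm (a 1) x)); auto;
      [|apply hom_comm_r, Sa; lia].
    rewrite (gprod_single _ _ _ _ (n + 2 - i + 1 - b)); try lia.
    - unfold U. f_equal. f_equal; f_equal; lia.
    - intros l Hl Ne. rewrite comm_near by lia. apply gpow_gone. }
  assert (L : conj (comm (a 1) (a i)) = gone).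
  { rewrite comm_near by lia. unfold conj. group_eq. }
  rewrite (hom_comm (fun _ => True) conj sub_all hom_conj), !conj_eq in L; auto.
  fold w in L. fold v in L.
  assert (S1 := Sa 1 ltac:(lia)). assert (Si := Sa i ltac:(lia)).
  rewrite (hom_comm_l (gmul (a i) v)) in L; auto; [|now apply subgroup_mul].
  rewrite (hom_comm_r (a 1)), (hom_comm_r w) in L; auto.
  rewrite comm_near, Wv, Av, gmul1l, gmul1r in L by lia. exact L.
Qed.

(** * Vanishing of the exponents of w and of the end exponents *)

Section Exponents.
Context (x : nat -> Z) (Ew : w = gprod a x (seq 2 (n - 1))).

Lemma comm_w_gprod i : 1 <= i <= n ->
  comm w (a i) = gprod (fun m => comm (a m) (a i)) x (seq 2 (n - 1)).
Proof.
  intro Hi. rewrite Ew.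
  apply (hom_gprod (span a n) (fun x => comm x (a i))); auto.
  - apply hom_comm_l, span_in. lia.
  - intros k Hk. apply in_seq in Hk. apply span_in. lia.
Qed.

Lemma gpow_comm_dvd m i z : 1 <= m <= n -> 1 <= i <= n ->
  (Z.of_nat p | z)%Z -> gpow (comm (a m) (a i)) z = gone.
Proof.
  intros Hm Hi D.
  rewrite <- (hom_gpow (span a n) (fun x => comm x (a i)));
    auto; try apply hom_comm_l; try (apply span_in; lia).
  rewrite gpow_a_dvd by (auto; lia). group_eq.
Qed.

Lemma gpow_comm_near m i z : 1 <= m <= n -> 1 <= i <= n -> m < i + c -> i < m + c ->
  gpow (comm (a m) (a i)) z = gone.
Proof.
  intros. replace (comm (a m) (a i)) with (@gone G); [apply gpow_gone|].
  symmetry. apply comm_eq1, (commute_near c); auto; lia.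
Qed.

(** In the expansion of [comm w (a i)] factors with [m > i - c] commute with [a i] and those with
    [m < i - c] vanish by hypothesis. What remains is a power of [U (i - c - 1)], to be compared
    with a power of [U (b - 1)]. *)
Lemma low_step i y :
  c < i <= n -> comm (a 1) (a i) = gprod a y (seq b (i + 2 - 2 * b)) ->
  (forall m, 2 <= m < i - c -> (Z.of_nat p | x m)%Z) ->
  (Z.of_nat p | y b)%Z /\ (2 <= i - c -> (Z.of_nat p | x (i - c)%nat)%Z).
Proof.
  intros Hi E IH. assert (W := comm_w_far i y Hi E).
  rewrite comm_w_gprod in W by lia.
  destruct (Nat.eq_dec i (S c)) as [->|Ne].
  - rewrite gprod_trivial in W.
    (* Here [i - c = 1], and [w] has no factor [a 1]. The identity is written as a zeroth power so
       that independence applies. *)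
    + split; [|lia]. rewrite <- (gpow0 (U 0)) in W.
      apply (U_independent 0 (b - 1)) in W; [tauto|lia].
    + intros m Hm. apply in_seq in Hm. apply gpow_comm_near; lia.
  - rewrite (gprod_single _ _ _ _ (i - c)) in W; try lia.
    + replace (comm (a (i - c)) (a i)) with (U (i - c - 1)) in W
        by (unfold U; f_equal; f_equal; lia).
      apply U_independent in W; [tauto|lia].
    + intros m Hm Nm. destruct (le_lt_dec m (i - c)).
      * apply gpow_comm_dvd; try lia. apply IH. lia.
      * apply gpow_comm_near; lia.
Qed.

Lemma low_exponents m : 2 <= m < b -> (Z.of_nat p | x m)%Z.
Proof.
  induction m as [m IH] using lt_wf_ind. intro Hm.
  destruct (comm_far_exponents (c + m) ltac:(lia)) as [y E].
  replace m with (c + m - c) by lia.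
  apply (low_step (c + m) y); try lia; auto.
  intros k Hk. apply IH; lia.
Qed.

Lemma bottom_exponent i y :
  c < i <= n -> comm (a 1) (a i) = gprod a y (seq b (i + 2 - 2 * b)) ->
  (Z.of_nat p | y b)%Z.
Proof.
  intros Hi E. apply (low_step i y); auto.
  intros m Hm. apply low_exponents. lia.
Qed.

(** This is the hypothesis of [comm_w_near]; the low exponents are therefore settled before the high
    ones. *)
Lemma comm_w_Sc : comm w (a (S c)) = gone.
Proof.
  destruct (comm_far_exponents (S c) ltac:(lia)) as [y E].
  rewrite (comm_w_far (S c) y) by (auto; lia).
  apply U_gpow_dvd; [lia|]. apply (bottom_exponent (S c)); auto; lia.
Qed.

(** The mirror image of [low_step]: now only [m >= c + i] can contribute, and descending induction
    leaves [m = c + i], a power of [U (i - 1)] compared with one of [U 0]. For [i = b] that index is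
    [n + 1] and nothing remains. *)
Lemma high_step i y :
  2 <= i <= b ->
  comm (a 1) (a (n + 2 - i)) = gprod a y (seq b (n + 2 - i + 2 - 2 * b)) ->
  (forall m, c + i < m <= n -> (Z.of_nat p | x m)%Z) ->
  (Z.of_nat p | y (n + 2 - i + 1 - b)%nat)%Z /\ (c + i <= n -> (Z.of_nat p | x (c + i)%nat)%Z).
Proof.
  intros Hi E IH. assert (W := comm_w_near i y Hi E comm_w_Sc).
  rewrite comm_w_gprod in W by lia.
  destruct (Nat.eq_dec i b) as [->|Ne].
  - rewrite gprod_trivial, gmul1r in W.
    + split; [|lia]. rewrite <- (gpow0 (U 1)) in W.
      apply U_independent in W; [tauto|lia].
    + intros m Hm. apply in_seq in Hm. apply gpow_comm_near; lia.
  - rewrite (gprod_single _ _ _ _ (c + i)) in W; try lia.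
    + replace (comm (a (c + i)) (a i)) with (gpow (U (i - 1)) (- 1)) in W.
      2: { change (- 1)%Z with (- (1))%Z. rewrite gpowN, gpow1. unfold U.
           rewrite ginv_comm. f_equal; f_equal; lia. }
      rewrite <- gpowM in W.
      assert (W' : gpow (U 0) (y (n + 2 - i + 1 - b)) = gpow (U (i - 1)) (x (c + i))).
      { apply (gmul_cancel_r (gpow (U (i - 1)) (- 1 * x (c + i)))).
        rewrite W, <- gpowD, <- (gpow0 (U (i - 1))). f_equal. lia. }
      apply U_independent in W'; [tauto|lia].
    + intros m Hm Nm. destruct (le_lt_dec (c + i) m).
      * apply gpow_comm_dvd; try lia. apply IH. lia.
      * apply gpow_comm_near; lia.
Qed.

Lemma high_exponents m : S c < m <= n -> (Z.of_nat p | x m)%Z.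
Proof.
  intro Hm. remember (n - m) as k eqn:Ek. revert m Hm Ek.
  induction k as [k IH] using lt_wf_ind. intros m Hm Ek.
  destruct (comm_far_exponents (n + 2 - (m - c)) ltac:(lia)) as [y E].
  replace m with (c + (m - c)) by lia.
  apply (high_step (m - c) y); try lia; auto.
  intros m' Hm'. apply (IH (n - m')); lia.
Qed.

(** The reflection of [i] to [n + 2 - i] exchanges the ranges [c < i <= n] and [2 <= i <= b]. *)
Lemma top_exponent i y :
  c < i <= n -> comm (a 1) (a i) = gprod a y (seq b (i + 2 - 2 * b)) ->
  (Z.of_nat p | y (i + 1 - b)%nat)%Z.
Proof.
  intros Hi E. replace i with (n + 2 - (n + 2 - i)) in E |- * by lia.
  apply high_step; auto; try lia.
  intros m Hm. apply high_exponents. lia.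
Qed.

End Exponents.

Lemma lifting_comm_far m :
  c < m <= n -> exists y, comm (a 1) (a m) = gprod a y (seq (S b) (m - 2 * b)).
Proof.
  intro Hm. destruct (collect a n comm_below 2 (n - 1) w) as [x Ew]; auto; try lia.
  destruct (comm_far_exponents m Hm) as [y E].
  assert (B := bottom_exponent x Ew m y Hm E).
  assert (T := top_exponent x Ew m y Hm E).
  assert (V : forall i, i = b \/ i = m + 1 - b -> gpow (a i) (y i) = gone).
  { intros i [->| ->]; apply gpow_a_dvd; auto; lia. }
  exists y. rewrite E.
  (* For [m = 2 * b - 1] both ends of the range are [b], and truncated subtraction gives the empty
     product. *)
  destruct (Nat.eq_dec m (2 * b - 1)) as [Em|Nm].
  - replace (m - 2 * b) with 0 by lia.
    rewrite gprod_trivial; [reflexivity|].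
    intros i Hi. apply in_seq in Hi. apply V. lia.
  - apply gprod_restrict; try lia; intros i Hi; apply V; lia.
Qed.

Lemma lifting_comm_last :
  exists x, comm (a 1) (a (S n)) = gprod a x (seq b (c + 2 - b)).
Proof.
  destruct (collect a n comm_below 2 (n - 1) w) as [x Ew]; auto; try lia.
  exists x. fold w. rewrite Ew.
  apply gprod_restrict; try lia; intros i Hi; apply gpow_a_dvd; try lia.
  - apply (low_exponents x Ew). lia.
  - apply (high_exponents x Ew). lia.
Qed.

End Lifting.

(** * Cyclic quotients *)

Section CyclicQuotient.
Context {G : group} (H : G -> Prop).
Context (HH : subgroup H) (NH : forall g x, H x -> H (gmul (gmul (ginv g) x) g)).

Lemma coset_gpow x h z : H h -> exists h', H h' /\ gpow (gmul x h) z = gmul (gpow x z) h'.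
Proof.
  intro Hh. induction z as [|z IH|z IH] using Z.peano_ind.
  - exists gone. split; [now apply (subgroup_one H)|]. rewrite !gpow0. group_eq.
  - destruct IH as (h' & Hh' & E). rewrite !gpow_succ, E. eexists. split.
    + apply (subgroup_mul H); [exact HH|apply (NH (gpow x z)), Hh|exact Hh'].
    + group_eq.
  - destruct IH as (h' & Hh' & E). rewrite !gpow_pred, E. eexists. split.
    + apply (subgroup_mul H); [exact HH| |exact Hh'].
      apply (NH (gmul (ginv x) (gpow x z))), (subgroup_inv H _ HH Hh).
    + group_eq.
Qed.

(** The generator [g] given by the definition need not be [s], but it is a power of [s] modulo [H].
    So if the power [z] of [s] lies in [H], the same power of [g] does too. *)
Lemma quot_cyclic_dvd p s z :
  quot_cyclic_order p (fun _ => True) H ->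
  (forall x, exists m h, H h /\ x = gmul (gpow s m) h) ->
  H (gpow s z) -> (Z.of_nat p | z)%Z.
Proof.
  intros (g & _ & _ & Hg) Hs Hz. apply Hg.
  destruct (Hs g) as (m & h & Hh & ->).
  destruct (coset_gpow (gpow s m) h z Hh) as (h' & Hh' & ->).
  apply (subgroup_mul H); auto.
  rewrite <- gpowM, Z.mul_comm, gpowM. now apply subgroup_gpow.
Qed.

Lemma gen_normal_factor (l : list G) s x :
  (forall y, In y l -> y = s \/ H y) -> gen l x ->
  exists m h, H h /\ x = gmul (gpow s m) h.
Proof.
  intros Hl Hx. apply Hx.
  - split; [|split].
    + exists 0%Z, gone. split; [now apply (subgroup_one H)|]. rewrite gpow0. group_eq.
    + intros y y' (m & h & Hh & ->) (m' & h' & Hh' & ->).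
      exists (m + m')%Z. eexists. split.
      * apply (subgroup_mul H); [exact HH|apply (NH (gpow s m')), Hh|exact Hh'].
      * rewrite gpowD. group_eq.
    + intros y (m & h & Hh & ->). exists (- m)%Z. eexists. split.
      * apply (NH (gpow s (- m))), (subgroup_inv H _ HH Hh).
      * rewrite gpowN. group_eq.
  - intros y Hy. destruct (Hl y Hy) as [->|Hy'].
    + exists 1%Z, gone. split; [now apply (subgroup_one H)|]. rewrite gpow1. group_eq.
    + exists 0%Z, y. split; auto. rewrite gpow0. group_eq.
Qed.

End CyclicQuotient.

(** * Derivation of the presentation from the SSP conditions *)

Theorem theorem6p2 (p n j : nat) (Gh : group) (F : Gh -> Gh) (a : nat -> Gh) :
  (p = 0 \/ prime (Z.of_nat p)) ->   (* p = 0 encodes p = infinity *)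
  3 <= n -> j + 1 <= qn n ->
  (* G^ (the whole group Gh) is an SSP group of length n+1 w.r.t.
     (G^, <a_1..a_n>, F), with canonical basis (a_1..a_{n+1}) *)
  SSP p (fun _ => True) (gen (map a (seq 1 n))) F ->
  ssp_length p (fun _ : Gh => True) (n + 1) ->
  canonical_basis (fun _ => True) (gen (map a (seq 1 n))) F a (n + 1) ->
  (* G = <a_1..a_n> (lifted by G^) is an SSP group of length n w.r.t.
     (G, <a_1..a_{n-1}>, F|) with canonical basis (a_1..a_n) *)
  SSP p (gen (map a (seq 1 n))) (gen (map a (seq 1 (n - 1)))) F ->
  ssp_length p (gen (map a (seq 1 n))) n ->
  canonical_basis (gen (map a (seq 1 n))) (gen (map a (seq 1 (n - 1)))) F a n ->
  (* G is of G(n, c(n,j))-type, non-abelian, of nilpotency class 2 *)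
  cutoff_point a n (cnj n j) ->
  nilclass2 (gen (map a (seq 1 n))) ->
  (* G satisfies the relations R(n,j) and their shifts *)
  (forall t, 1 + t <= n -> gpow (a (1 + t)) (Z.of_nat p) = gone) ->
  (forall t i, 2 <= i <= cnj n j -> i + t <= n -> comm (a (1 + t)) (a (i + t)) = gone) ->
  (forall t k, k <= qn n - j - 1 -> cnj n j + 1 + k + t <= n ->
     gen (map a (seq (qn n + 1 - j + t)
                     (qn n + 1 + rn n + 2 * j + k + 1 - (qn n + 1 - j))))
         (comm (a (1 + t)) (a (cnj n j + 1 + k + t)))) ->
  comm (a 1) (a (cnj n j + 1)) <> gone ->
  (* conclusion *)
  exists (e : nat -> nat -> Z) (d : nat -> Z),
    presents (fun _ : Gh => True) a (n + 1) (Rhat p n j e d) /\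
    comm (a 1) (a (cnj n j + 1)) <> gone.
Proof.
  intros Hp Hn3 Hj (_ & SH & _ & homF & _ & _ & _ & _ & HN & Hquot) _ [Hbase1 Hbase2]
    _ _ _ _ [_ Hclass] Hpow Hnear Hfar Hne.
  unfold Rhat. cbv zeta.
  assert (Hqr : n = 3 * qn n + rn n /\ rn n < 3).
  { split; [apply (Nat.div_mod n 3); lia | apply Nat.mod_upper_bound; lia]. }
  assert (Hc : cnj n j = 2 * qn n + rn n + j) by reflexivity.
  set (c := cnj n j) in *. set (q := qn n) in *. set (r := rn n) in *.
  clearbody c q r. rewrite Nat.add_1_r in Hne.
  set (b := q + 1 - j).
  assert (Hnbc : n + 1 = b + c) by lia. assert (Hb : 2 <= b) by lia.
  assert (Hbc : 2 * b <= c + 2) by lia.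
  assert (Fa : forall i, 1 <= i <= n -> F (a i) = a (S i)).
  { intros i Hi. symmetry. apply Hbase1. lia. }
  destruct (HN 0) as ((_ & _ & NH) & (_ & _ & NG1) & _).
  assert (normA : forall g x, span a n x -> span a n (gmul (gmul (ginv g) x) g)).
  { intros g x Hx. apply NH; [exact I|exact Hx]. }
  assert (Hall : forall x, gen (map a (seq 1 (n + 1))) x).
  { intro x. destruct (Hbase2 0 ltac:(lia)) as [E _].
    replace (n + 1) with (n + 1 - 0) by lia. apply E. exact I. }
  (* Condition (4) at [k = 0]; the nontrivial commutator [Hne] shows that the whole group is
     nontrivial. *)
  assert (ordn : forall z, span a n (gpow (a (S n)) z) -> (Z.of_nat p | z)%Z).
  { intro z. apply (quot_cyclic_dvd (span a n) SH normA p).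
    - apply (Hquot 0). intro T. apply Hne, T. exact I.
    - intro x. apply (gen_normal_factor (span a n) SH normA) with (2 := Hall x).
      intros y Hy. apply in_map_iff in Hy. destruct Hy as [i [<- Hi]].
      apply in_seq in Hi. destruct (Nat.eq_dec i (S n)) as [->|Ne]; [now left|].
      right. apply span_in. lia. }
  (* The commutator lies in the normal subgroups [span a n] and [Gk] at 1, hence in their
     intersection [Hk] at 1, which the canonical basis identifies. *)
  assert (comm_last : gen (map a (seq 2 (n - 1))) (comm (a 1) (a (S n)))).
  { destruct (Hbase2 1 ltac:(lia)) as [EG EH].
    replace (n - 1) with (n + 1 - 1 - 1) by lia. apply (proj1 (EH _)). split.
    - replace (comm (a 1) (a (S n))) with
        (gmul (ginv (a 1)) (gmul (gmul (ginv (a (S n))) (a 1)) (a (S n)))) by group_eq.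
      apply (subgroup_mul (span a n)); [exact SH| |].
      + apply (subgroup_inv (span a n)); [exact SH|]. apply span_in. lia.
      + apply normA, span_in. lia.
    - change (Gk (fun _ => True) (gen (map a (seq 1 n))) F 1 (comm (a 1) (a (S n)))).
      replace (comm (a 1) (a (S n))) with
        (gmul (gmul (gmul (ginv (a 1)) (ginv (a (S n)))) (a 1)) (a (S n))) by group_eq.
      assert (L : gen (map a (seq 2 (n + 1 - 1))) (a (S n))) by (apply gen_seq_in; lia).
      apply (proj2 (EG _)), (subgroup_mul (gen _)); auto using gen_subgroup.
      apply (proj1 (EG _)), NG1; [exact I|]. apply (proj2 (EG _)), (subgroup_inv (gen _)); auto using gen_subgroup. }
  assert (powp : forall i, 1 <= i <= n -> gpow (a i) (Z.of_nat p) = gone).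
  { intros i Hi. replace i with (1 + (i - 1)) by lia. apply Hpow. lia. }
  assert (near : forall i, 2 <= i <= c -> comm (a 1) (a i) = gone).
  { intros i Hi. assert (N := Hnear 0 i Hi ltac:(lia)). now rewrite !Nat.add_0_r in N. }
  assert (far : forall t m, c < m -> m + t <= n ->
     gen (map a (seq (b + t) (m + 2 - 2 * b))) (comm (a (1 + t)) (a (m + t)))).
  { intros t m Hm Ht. assert (R := Hfar t (m - c - 1) ltac:(lia) ltac:(lia)).
    replace (c + 1 + (m - c - 1) + t) with (m + t) in R by lia.
    revert R. apply gen_seq_mono; lia. }
  (* The bound on [k] is put under the quantifier so that choice yields a total [e]; outside the
     range the exponents default to 0. *)
  assert (X : forall k, exists y, k <= q - j - 1 ->
    comm (a 1) (a (c + 1 + k)) = gprod a y (seq (S b) (c + 1 + k - 2 * b))).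
  { intro k. destruct (le_lt_dec k (q - j - 1)) as [Hk|Hk].
    - destruct (lifting_comm_far F a n homF Fa p ltac:(lia) powp ordn b c) with (m := c + 1 + k) as [y Ey];
        auto; [lia|]. now exists y.
    - exists (fun _ => 0%Z). lia. }
  destruct (choice _ X) as [e He].
  destruct (lifting_comm_last F a n homF Fa p ltac:(lia) powp ordn b c) as [d Hd]; auto.
  exists e, d. split; [|now rewrite Nat.add_1_r].
  apply (presents_of_collection a p); auto.
  - intros u v [(t & Ht & -> & ->)|[(t & i & Hi & Ht & -> & ->)
      |[(t & k & Hk & _ & Ht & -> & ->)|[-> ->]]]].
    + rewrite weval_wpow. apply (powp_last F a n); auto; lia.
    + simpl. apply (comm_eq1 (a (S t))), (commute_near F a n homF Fa c); auto; lia.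
    + rewrite weval_wprod.
      replace (seq (q + 2 - j) _) with (seq (S b) (c + 1 + k - 2 * b)) by (f_equal; lia).
      apply (comm_shift F a n); auto; lia.
    + rewrite (weval_wprod a (fun i => i)).
      replace (seq (q + 1 - j) _) with (seq b (c + 2 - b)) by (f_equal; lia).
      rewrite Nat.add_1_r. exact Hd.
  - intros x Ex i Hi. apply (exponents_dvd F a n homF Fa p) with (m := n + 1) (x := x); auto; lia.
  - intros K g Hg. split.
    + intros i Hi. rewrite <- (weval_wpow g (WGen i)). apply (Hg _ WOne).
      left. exists (i - 1). repeat split; [lia|]. do 2 f_equal. lia.
    (* The pair [(i, m)] is the shift by [t] of [(1, s)]. Relations (ii), (iii), (iv) cover
       [s <= c], [c < s <= n] and [s = n + 1], the last forcing [t = 0]; the right-hand sides use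
       only indices strictly between [i] and [m]. *)
    + intros i m H1 H2 H3. set (t := i - 1). set (s := m - t).
      replace i with (1 + t) by lia. replace m with (s + t) by lia.
      change (comm (g (1 + t)) (g (s + t)))
        with (weval g (wcomm (WGen (1 + t)) (WGen (s + t)))).
      destruct (le_lt_dec s c) as [Hs|Hs]; [|destruct (le_lt_dec s n) as [Hs'|Hs']].
      * rewrite (Hg _ WOne).
        -- exact (subgroup_one _ (gen_subgroup _)).
        -- right. left. exists t, s. repeat split; lia.
      * erewrite Hg.
        2: { right. right. left. exists t, (s - c - 1).
             replace (c + 1 + (s - c - 1) + t) with (s + t) by lia.
             repeat split; lia. }
        rewrite weval_wprod. apply gprod_in; [apply gen_subgroup|].
        intros l Hl. apply in_seq in Hl. apply gen_seq_in. lia.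
      * replace (1 + t) with 1 by lia. replace (s + t) with (n + 1) by lia.
        erewrite Hg by (right; right; right; split; reflexivity).
        rewrite (weval_wprod g (fun i => i)). apply gprod_in; [apply gen_subgroup|].
        intros l Hl. apply in_seq in Hl. apply gen_seq_in. lia.
Qed.
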